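(* There exists an absolute constant $K>0$ (independent of all parameters below) such that the following holds. Let $d\geq 2$, $r\geq 1$, $k\geq 1$, $0\leq s\leq d$ be integers, let $C>0$, and let $\varepsilon,\delta\in(0,1)$. Let $\mathcal{A}$ be the random subsampled Walsh--Hadamard measurement operator with $m$ measurements, let $\mathcal{X}^\star\in\mathfrak{M}_{r,s,k}(C)$, and let $\mathbf{y}=\mathcal{A}(\mathcal{X}^\star)$. If $$m\ \geq\ \frac{16(2k)2^s}{\varepsilon^2}\left[\log\frac{2}{\delta}+2d(2r)^2\log\left(\frac{16Kd\sqrt{2r}\,(2k)2^s}{\varepsilon}\right)\right],$$ then, with probability at least $1-\delta$, $\mathcal{X}^\star$ is the unique minimizer of $$\min_{\mathcal{X}\in\mathfrak{M}_{r,s,k}(C)}\ \|\mathcal{A}(\mathcal{X})-\mathbf{y}\|_2 .$$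
   Context: Let $N=2^d$. Tensors $\mathcal{X}\in\mathbb{R}^{2\times\cdots\times 2}$ have $d$ modes, each of size 2. Vectorization: $[\operatorname{vec}(\mathcal{X})]_j=\mathcal{X}(i_1,\ldots,i_d)$ with $j=1+\sum_{q=1}^d(i_q-1)2^{q-1}$, $i_q\in\{1,2\}$. The Frobenius norm is $\|\mathcal{X}\|_F=\|\operatorname{vec}(\mathcal{X})\|_2$. Measurement operator. Let $\mathbf{H}_2=\frac{1}{\sqrt2}\begin{bmatrix}1&1\\1&-1\end{bmatrix}$ and $\mathbf{H}=\mathbf{H}_2^{\otimes d}\in\mathbb{R}^{N\times N}$ (Kronecker power). Draw $\nu_1,\ldots,\nu_m$ independently and uniformly from $\{1,\ldots,N\}$ (with replacement), and let $\mathbf{S}\in\mathbb{R}^{m\times N}$ be the matrix with $[\mathbf{S}\mathbf{z}]_\ell=z_{\nu_\ell}$. Set $\mathbf{A}=\sqrt{N/m}\,\mathbf{S}\mathbf{H}$ and $\mathcal{A}(\mathcal{X})=\mathbf{A}\operatorname{vec}(\mathcal{X})\in\mathbb{R}^m$. TT rank. For $q=1,\ldots,d-1$, let $\mathbf{X}^{\langle q\rangle}$ be the $2^q\times 2^{d-q}$ matrix unfolding of $\mathcal{X}$ whose row index is $(i_1,\ldots,i_q)$ and column index is $(i_{q+1},\ldots,i_d)$. Then $\operatorname{rank}_{\mathrm{TT}}(\mathcal{X})=(\operatorname{rank}\mathbf{X}^{\langle 1\rangle},\ldots,\operatorname{rank}\mathbf{X}^{\langle d-1\rangle})$, and $\operatorname{rank}_{\mathrm{TT}}(\mathcal{X})\leq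 r$ for a scalar $r$ means every component is at most $r$. Low-order model. Write $[d]=\{1,\ldots,d\}$. For $S\subseteq[d]$, let $\mathcal{E}_S$ be the canonical basis tensor whose single nonzero entry, equal to 1, is at the index with $i_j=2$ for $j\in S$ and $i_j=1$ for $j\notin S$. Define $$\mathrm{LC}_k(s)=\left\{\sum_{t=1}^k\mathcal{X}_{S_t}\ :\ S_t\subseteq[d],\ |S_t|\leq s,\ \mathcal{X}_{S_t}\in\operatorname{span}\{\mathcal{E}_I:I\subseteq S_t\},\ t=1,\ldots,k\right\}.$$ Model class: $$\mathfrak{M}_{r,s,k}(C)=\left\{\mathcal{X}\in\mathbb{R}^{2\times\cdots\times2}:\ \operatorname{rank}_{\mathrm{TT}}(\mathcal{X})\leq r,\ \mathcal{X}\in\mathrm{LC}_k(s),\ \|\mathcal{X}\|_F\leq C\right\}.$$ *)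

(* Defs.v *)
From HB Require Import structures.
From mathcomp Require Import all_boot all_order all_algebra.
From mathcomp Require Export all_classical all_reals all_analysis.
From mathcomp.real_closed Require Export mxtens.

Set Implicit Arguments.
Unset Strict Implicit.
Unset Printing Implicit Defensive.

Import Order.TTheory GRing.Theory Num.Theory.

Local Open Scope classical_set_scope.
Local Open Scope ring_scope.

(* Indices are 0-based throughout: mode q in {1..d} is q-1 : 'I_d, the value
   i_q in {1,2} is i_q - 1 : 'I_2, and j in {1..2^d} is j-1 : 'I_(2 ^ d). *)
Notation mindex d := {ffun 'I_d -> 'I_2}.
(* R^o gives the type of tensors its finite-dimensional vector space
   structure over R. *)
Notation tensor R d := {ffun mindex d -> R^o}.

Definition digit (j q : nat) : 'I_2 := inord ((j %/ 2 ^ q) %% 2)%N.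

(* Little-endian: j = \sum_q i_q 2^q, see vecE below. *)
Definition vec (R : realType) (d : nat) (X : tensor R d) : 'cV[R]_(2 ^ d) :=
  \col_(j < 2 ^ d) X [ffun q : 'I_d => digit j q].

Lemma digit_sum (d : nat) (i : mindex d) (q : 'I_d) :
  digit (\sum_(p < d) i p * 2 ^ p)%N q = i q.
Proof.
pose f (p : nat) : nat := oapp (fun p' : 'I_d => nat_of_ord (i p')) 0%N (insub p).
have fE (p : 'I_d) : f p = i p by rewrite /f valK.
have f2 p : (f p < 2)%N by rewrite /f; case: insubP => //= u _ _; exact: ltn_ord.
have key n m : (((\sum_(0 <= p < n) f p * 2 ^ p) %/ 2 ^ m) %% 2 =
    if m < n then f m else 0)%N.
  have bnd k : (\sum_(0 <= p < k) f p * 2 ^ p < 2 ^ k)%N.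
    elim: k => [|k IH]; first by rewrite big_geq.
    rewrite big_nat_recr //= expnS mul2n -addnn.
    rewrite -addSn leq_add // -{2}(mul1n (2 ^ k)%N) leq_mul2r.
    by rewrite -ltnS f2 orbT.
  case: ltnP => mn; last by rewrite divn_small // (leq_trans (bnd n)) // leq_exp2l.
  rewrite (big_cat_nat _ (ltnW mn)) //= [X in (_ + X)%N]big_ltn //.
  have -> : (\sum_(m.+1 <= p < n) f p * 2 ^ p =
      (\sum_(m.+1 <= p < n) f p * 2 ^ (p - m.+1)) * 2 * 2 ^ m)%N.
    rewrite -mulnA -expnS big_distrl /= !big_nat.
    by apply: eq_bigr => p /andP[mp _]; rewrite -mulnA -expnD subnK.
  rewrite -mulnDl addnC divnMDl ?expn_gt0 // (divn_small (bnd m)) addn0.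
  by rewrite addnC modnMDl modn_small.
apply: val_inj; rewrite /digit /= inordK ?ltn_pmod //.
rewrite (eq_bigr (fun p : 'I_d => f p * 2 ^ p)%N) => [|p _]; last by rewrite fE.
by rewrite -(big_mkord xpredT (fun p => f p * 2 ^ p)%N) key ltn_ord fE.
Qed.

Lemma vecE (R : realType) (d : nat) (X : tensor R d) (i : mindex d)
    (j : 'I_(2 ^ d)) :
  nat_of_ord j = (\sum_(q < d) i q * 2 ^ q)%N -> vec X j 0 = X i.
Proof.
move=> jE; rewrite mxE; congr (X _); apply/ffunP => q.
by rewrite ffunE jE digit_sum.
Qed.

(* The library norm on matrices is the sup norm. *)
Definition norm2 (R : realType) (n : nat) (v : 'cV[R]_n) : R :=
  Num.sqrt (\sum_(j < n) v j 0 ^+ 2).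

Definition normF (R : realType) (d : nat) (X : tensor R d) : R := norm2 (vec X).

Definition hadamard2 (R : realType) : 'M[R]_2 :=
  (Num.sqrt 2)^-1 *: \matrix_(i < 2, j < 2) (-1) ^+ (i * j)%N.

(* ^t is the Kronecker power. *)
Definition hadamard (R : realType) (d : nat) : 'M[R]_(2 ^ d) :=
  hadamard2 R ^t d.

Definition sampling (R : realType) (d m : nat) (nu : 'I_m -> 'I_(2 ^ d)) :
    'M[R]_(m, 2 ^ d) :=
  \matrix_(l < m, j < 2 ^ d) (nu l == j)%:R.

Definition sensing_mx (R : realType) (d m : nat) (nu : 'I_m -> 'I_(2 ^ d)) :
    'M[R]_(m, 2 ^ d) :=
  Num.sqrt ((2 ^ d)%:R / m%:R) *: (sampling R nu *m hadamard R d).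

Definition measure_op (R : realType) (d m : nat) (nu : 'I_m -> 'I_(2 ^ d))
    (X : tensor R d) : 'cV[R]_m :=
  sensing_mx R nu *m vec X.

(* As V is finite, measurability is required on singletons only, and mutual
   independence is the product rule for every subfamily J and all B l. *)
Definition iid_uniform (R : realType) (dsp : measure_display)
    (Omega : measurableType dsp) (P : probability Omega R) (V : finType)
    (m : nat) (nu : 'I_m -> Omega -> V) : Prop :=
  [/\ forall l (v : V), measurable (nu l @^-1` [set v]),
      forall l (v : V), P (nu l @^-1` [set v]) = (#|V|%:R^-1)%:E
    & forall (J : {set 'I_m}) (B : 'I_m -> set V),
        P (\bigcap_(l in [set` J]) (nu l @^-1` B l)) =
        (\prod_(l in J) P (nu l @^-1` B l))%E].

(* Rows are indexed by the first q modes and columns by the last d - q. *)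
Definition unfolding (R : realType) (d q : nat) (X : tensor R d) :
    'M[R]_(2 ^ q, 2 ^ (d - q)) :=
  \matrix_(a < 2 ^ q, b < 2 ^ (d - q))
    X [ffun p : 'I_d => if (p < q)%N then digit a p else digit b (p - q)].

(* Component number q (from 0) is the rank of the unfolding with 2 ^ (q + 1)
   rows. *)
Definition tt_rank (R : realType) (d : nat) (X : tensor R d) :
    (d.-1).-tuple nat :=
  [tuple \rank (unfolding q.+1 X) | q < d.-1].

Definition tt_rank_le (R : realType) (d : nat) (X : tensor R d) (r : nat) :
    Prop :=
  forall q : 'I_d.-1, (tnth (tt_rank X) q <= r)%N.

Definition basis_tensor (R : realType) (d : nat) (S : {set 'I_d}) :
    tensor R d :=
  [ffun i => (i == [ffun p => if p \in S then ord_max else ord0])%:R].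

Definition span_tensor (R : realType) (d : nat) (S : {set 'I_d}) :
    {vspace tensor R d} :=
  <<[seq basis_tensor R J | J <- enum (powerset S)]>>%VS.

Definition low_order (R : realType) (d s k : nat) : set (tensor R d) :=
  [set X | exists (S : 'I_k -> {set 'I_d}) (Y : 'I_k -> tensor R d),
      (forall t, (#|S t| <= s)%N /\ Y t \in span_tensor R (S t)) /\
      X = \sum_(t < k) Y t].

Definition model_class (R : realType) (d r s k : nat) (C : R) :
    set (tensor R d) :=
  [set X | [/\ tt_rank_le X r, low_order s k X & normF X <= C]].

Definition minimizers (R : realType) (T : Type) (D : set T) (f : T -> R) :
    set T :=
  [set x | D x /\ forall y, D y -> f x <= f y].

(* Main.v *)
(** It suffices that A does not vanish on the unit-norm tensors of TT rank at
    most rho = 2r with at most B = 2k 2^s nonzero entries, as the normalized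
    difference of two elements of the model class is one of these.

    Covering: left-orthogonalizing a tensor train makes all its cores
    contractions, so perturbing each core by kappa in Frobenius norm moves a
    unit tensor by at most about d kappa, without exponential growth in d.
    Rounding the core entries to a grid thus gives a net at distance 1 / (4B) of
    cardinality (O(d rho B))^(2 rho^2 (d+1)).

    Probability: since H is orthogonal and its entries have square 1/N, a unit
    vector v with at most B nonzero entries has row energies N (Hv)_j^2 of mean
    1 and maximum at most B, so a proportion at least 3/(4B) of them is at least
    1/4; all m samples miss those rows with probability at most exp(-3m/(4B)).
    If A X = 0 and Y is the net point of X, then X - Y still has at most 2B
    nonzero entries, so N (H(X - Y))_j^2 <= 2B / (4B)^2 < 1/4 and all m samples
    miss the high-energy rows of Y. A union bound over the net concludes, with
    K = 1. *)

Require Import Defs.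
From HB Require Import structures.
From mathcomp Require Import all_boot all_order all_algebra.
From mathcomp Require Import all_classical all_reals all_analysis.
From mathcomp Require Import ring lra zify.

Set Implicit Arguments.
Unset Strict Implicit.
Unset Printing Implicit Defensive.

Import Order.TTheory GRing.Theory Num.Theory.

Local Open Scope classical_set_scope.
Local Open Scope ring_scope.

(** * Euclidean sums, contractions and grid nets of matrices *)

Section EuclideanSums.
Variable R : realType.

Lemma sum_sqr_ge0 (I : finType) (f : I -> R) : 0 <= \sum_i f i ^+ 2.
Proof. by apply: sumr_ge0 => i _; exact: sqr_ge0. Qed.

Lemma sum_mul_sqr_le (I : finType) (f g : I -> R) :
  (\sum_i f i * g i) ^+ 2 <= (\sum_i f i ^+ 2) * (\sum_i g i ^+ 2).
Proof.
set t := \sum_i f i * g i; set F := \sum_i f i ^+ 2; set G := \sum_i g i ^+ 2.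
have G0 : 0 <= G by exact: sum_sqr_ge0.
(* Cauchy-Schwarz from the nonnegativity of this sum of squares; [G = 0] is treated apart, as [G]
   cannot be cancelled then. *)
have key : \sum_i (f i * G - g i * t) ^+ 2 = G * (F * G - t ^+ 2).
  have -> : G * (F * G - t ^+ 2) = F * G ^+ 2 - (2 * t * G) * t + t ^+ 2 * G.
    by move: t F G G0 => t F G _; ring.
  rewrite [X in X - _]big_distrl [X in _ - X]big_distrr [X in _ + X]big_distrr /=.
  rewrite -sumrB -big_split /=.
  by apply: eq_bigr => i _; ring.
have := sum_sqr_ge0 (fun i => f i * G - g i * t); rewrite key.
move: G0; rewrite le_eqVlt => /predU1P[/esym G0 _|Gp]; last first.
  by rewrite pmulr_rge0 // subr_ge0.
have g0 i : g i = 0.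
  have /eqP := G0; rewrite psumr_eq0; last by move=> j _; exact: sqr_ge0.
  by move=> /allP/(_ i (mem_index_enum _)); rewrite sqrf_eq0 => /eqP.
have -> : t = 0 by rewrite /t big1 // => i _; rewrite g0 mulr0.
by rewrite G0 mulr0 expr0n.
Qed.

(** Minkowski's inequality in squared form, with bounds [a] and [b] so that no root has to be
    taken. *)
Lemma sum_sqr_add_le (I : finType) (f g : I -> R) (a b : R) :
  0 <= a -> 0 <= b -> \sum_i f i ^+ 2 <= a ^+ 2 -> \sum_i g i ^+ 2 <= b ^+ 2 ->
  \sum_i (f i + g i) ^+ 2 <= (a + b) ^+ 2.
Proof.
move=> a0 b0 fa gb.
have -> : \sum_i (f i + g i) ^+ 2 =
    \sum_i f i ^+ 2 + 2 * (\sum_i f i * g i) + \sum_i g i ^+ 2.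
  rewrite big_distrr /= -!big_split /=.
  by apply: eq_bigr => i _; ring.
suff : \sum_i f i * g i <= a * b by move=> *; lra.
have ab0 : 0 <= a * b by rewrite mulr_ge0.
rewrite (le_trans (ler_norm _)) // -(@ler_pXn2r _ 2) ?nnegrE //.
rewrite -normrX ger0_norm ?sqr_ge0 //.
rewrite (le_trans (sum_mul_sqr_le f g)) // exprMn.
by apply: ler_pM => //; exact: sum_sqr_ge0.
Qed.

Definition sqn n (v : 'cV[R]_n) : R := \sum_i v i 0 ^+ 2.

Lemma sqn_ge0 n (v : 'cV[R]_n) : 0 <= sqn v.
Proof. exact: sum_sqr_ge0. Qed.

Lemma sqn0 n : sqn (0 : 'cV[R]_n) = 0.
Proof. by rewrite /sqn big1 // => i _; rewrite mxE expr0n. Qed.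

Lemma sqn_eq0 n (v : 'cV[R]_n) : sqn v = 0 -> v = 0.
Proof.
move=> /eqP; rewrite psumr_eq0; last by move=> j _; exact: sqr_ge0.
move=> /allP v0; apply/colP => i.
by have := v0 i (mem_index_enum _); rewrite sqrf_eq0 mxE => /eqP.
Qed.

Lemma sqnE n (v : 'cV[R]_n) : (sqn v)%:M = v^T *m v.
Proof.
apply/matrixP => i j; rewrite !ord1 !mxE eqxx mulr1n.
by apply: eq_bigr => k _; rewrite !mxE expr2.
Qed.

Lemma sqnZ n (a : R) (v : 'cV[R]_n) : sqn (a *: v) = a ^+ 2 * sqn v.
Proof.
by rewrite /sqn big_distrr /=; apply: eq_bigr => i _; rewrite mxE exprMn.
Qed.

Lemma sum_sqn_add_le (I : finType) n (F G : I -> 'cV[R]_n) (a b : R) :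
  0 <= a -> 0 <= b -> \sum_i sqn (F i) <= a ^+ 2 -> \sum_i sqn (G i) <= b ^+ 2 ->
  \sum_i sqn (F i + G i) <= (a + b) ^+ 2.
Proof.
move=> a0 b0; rewrite /sqn !pair_big /= => Fa Gb.
have := sum_sqr_add_le a0 b0 Fa Gb.
by congr (_ <= _); apply: eq_bigr => -[i j] _; rewrite mxE.
Qed.

Lemma sqn_col_mx n1 n2 (u : 'cV[R]_n1) (v : 'cV[R]_n2) :
  sqn (col_mx u v) = sqn u + sqn v.
Proof.
rewrite /sqn big_split_ord /=.
by congr (_ + _); apply: eq_bigr => i _; rewrite (col_mxEu, col_mxEd).
Qed.

Lemma sqn_mulmx_le m n (A : 'M[R]_(m, n)) (v : 'cV[R]_n) :
  sqn (A *m v) <= (\sum_i \sum_j A i j ^+ 2) * sqn v.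
Proof.
rewrite /sqn big_distrl /=; apply: ler_sum => i _; rewrite mxE.
exact: sum_mul_sqr_le.
Qed.

Definition contractive_mx m n (Q : 'M[R]_(m, n)) :=
  forall x : 'cV[R]_n, sqn (Q *m x) <= sqn x.

(** [Q^T *m Q] is an orthogonal projection and [Q *m x] has the norm of the projection of [x], so
    Pythagoras applies. *)
Lemma partial_isometry_contraction m n (Q : 'M[R]_(m, n)) :
  Q *m Q^T *m Q = Q -> contractive_mx Q.
Proof.
move=> QE x; pose E := Q^T *m Q.
have ET : E^T = E by rewrite /E trmx_mul trmxK.
have key : (sqn x)%:M = (sqn (Q *m x))%:M + (sqn (x - E *m x))%:M :> 'M[R]_1.
  rewrite !sqnE trmx_mul (linearB trmx) /= (trmx_mul E) ET mulmxBl !mulmxBr !mulmxA.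
  have -> : x^T *m Q^T *m Q *m Q^T *m Q = x^T *m Q^T *m Q.
    by rewrite -!mulmxA (mulmxA Q) QE.
  by rewrite subrr subr0 addrC subrK.
move/matrixP/(_ 0 0): key; rewrite !mxE eqxx !mulr1n => ->.
by rewrite lerDl sqn_ge0.
Qed.

Lemma partial_isometry_tr m n (Q : 'M[R]_(m, n)) :
  Q *m Q^T *m Q = Q -> Q^T *m Q^T^T *m Q^T = Q^T.
Proof. by move=> QE; rewrite -[X in _ = X^T]QE !trmx_mul trmxK !mulmxA. Qed.

Lemma contraction_entry m n (Q : 'M[R]_(m, n)) i j :
  contractive_mx Q -> `|Q i j| <= 1.
Proof.
move=> /(_ (delta_mx j 0)); rewrite -colE.
have -> : sqn (delta_mx j 0) = 1.
  rewrite /sqn (bigD1 j) //= mxE !eqxx expr1n big1 ?addr0 // => l lj.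
  by rewrite mxE (negbTE lj) expr0n.
rewrite /sqn (bigD1 i) //= mxE => H.
rewrite -(@expr_le1 _ 2) // real_normK ?num_real //.
by apply: le_trans H; rewrite lerDl; apply: sumr_ge0 => l _; exact: sqr_ge0.
Qed.

(** A partial isometry stands in for an orthonormal basis of the column space: a column dependent on
    the previous ones yields a zero column, and the shape of [U] is kept. *)
Lemma gram_schmidt m n (U : 'M[R]_(m, n)) :
  exists Q : 'M[R]_(m, n), Q *m Q^T *m Q = Q /\ Q *m Q^T *m U = U.
Proof.
elim: n U => [|n IH]; first by move=> U; exists 0; rewrite !thinmx0.
rewrite -addn1 => U.
have [Q1 [QQ QU]] := IH (lsubmx U).
pose u := rsubmx U; pose v := u - Q1 *m Q1^T *m u.
have Q1v : Q1^T *m v = 0.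
  rewrite /v mulmxBr !mulmxA.
  by have := partial_isometry_tr QQ; rewrite trmxK => ->; rewrite subrr.
pose q : 'cV[R]_m := (Num.sqrt (sqn v))^-1 *: v.
have Q1q : Q1^T *m q = 0 by rewrite /q -scalemxAr Q1v scaler0.
have qQ1 : q^T *m Q1 = 0 by rewrite -[LHS]trmxK trmx_mul trmxK Q1q linear0.
have qqv : q *m q^T *m v = v.
  rewrite -mulmxA /q linearZ /= -!scalemxAl -scalemxAr -sqnE scalerA.
  have [/sqn_eq0 ->|v0] := eqVneq (sqn v) 0; first by rewrite mul0mx scaler0.
  rewrite mul_mx_scalar scalerA -expr2 exprVn sqr_sqrtr ?sqn_ge0 //.
  by rewrite mulVf // scale1r.
have qqq : q *m q^T *m q = q by rewrite {3}/q -scalemxAr qqv.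
exists (row_mx Q1 q); rewrite tr_row_mx mul_row_col; split.
  rewrite mul_mx_row !mulmxDl QQ -(mulmxA q) qQ1 mulmx0 addr0.
  by rewrite -(mulmxA Q1) Q1q mulmx0 add0r qqq.
rewrite -[U in LHS]hsubmxK -[RHS]hsubmxK mul_mx_row !mulmxDl QU.
rewrite -{2}QU !mulmxA -(mulmxA q) qQ1 mulmx0 !mul0mx addr0 -/u.
have -> : q *m q^T *m u = v.
  have -> : u = v + Q1 *m Q1^T *m u by rewrite /v subrK.
  by rewrite mulmxDr qqv !mulmxA -(mulmxA q) qQ1 mulmx0 !mul0mx addr0.
by rewrite /v addrC subrK.
Qed.

(* The centres g c are taken in S itself: for contractions this keeps errors
   from being amplified along a tensor train. *)
Lemma grid_net m n (L : nat) (S : 'M[R]_(m, n) -> Prop) :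
  (0 < L)%N -> (forall Q, S Q -> forall i j, `|Q i j| <= 1) ->
  (exists Q, S Q) ->
  exists g : 'M['I_(2 * L).+1]_(m, n) -> 'M[R]_(m, n),
    (forall c, S (g c)) /\
    (forall Q, S Q -> exists c, forall i j, `|Q i j - g c i j| <= L%:R^-1).
Proof.
move=> L0 S1 [Q0 SQ0].
have L0' : 0 < L%:R :> R by rewrite ltr0n.
(* An entry in [-1, 1] falls in one of the cells 0, ..., 2L of width 1/L, the last one being reached
   only at 1. *)
pose cell (Q : 'M[R]_(m, n)) : 'M['I_(2 * L).+1]_(m, n) :=
  \matrix_(i, j) inord (Num.truncn (L%:R * (Q i j + 1))).
(* [Q0] is the default for the cell patterns that [S] does not meet. *)
have /choice[g gP] c : exists Q, S Q /\
    ((exists Q', S Q' /\ cell Q' = c) -> cell Q = c).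
  have [[Q [SQ <-]]|H] := pselect (exists Q', S Q' /\ cell Q' = c).
    by exists Q.
  by exists Q0.
exists g; split=> [c|Q SQ]; first exact: (gP c).1.
exists (cell Q) => i j.
have [Sg /(_ (ex_intro _ Q (conj SQ erefl)))] := gP (cell Q).
move=> /matrixP/(_ i j); rewrite !mxE => /(congr1 (@nat_of_ord _)).
have bnd (x : R) : `|x| <= 1 ->
    (0 <= L%:R * (x + 1)) /\ (Num.truncn (L%:R * (x + 1)) < (2 * L).+1)%N.
  rewrite ler_norml => /andP[x1 x2].
  have x0 : 0 <= L%:R * (x + 1) by apply: mulr_ge0; [exact: ltW | lra].
  split=> //; rewrite ltnS truncn_le_nat -natr1 natrM.
  have : L%:R * (x + 1) <= L%:R * 2 by rewrite ler_pM2l //; lra.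
  lra.
have [a0 aL] := bnd _ (S1 _ Sg i j).
have [b0 bL] := bnd _ (S1 _ SQ i j).
rewrite !inordK // => E.
have /andP[] := truncn_itv a0; have /andP[] := truncn_itv b0; rewrite E.
rewrite -natr1 => h1 h2 h3 h4.
rewrite ler_norml -(ler_pM2l L0') -[X in _ && X](ler_pM2l L0') mulrN.
by rewrite mulfV ?gt_eqF // mulrBr; apply/andP; split; lra.
Qed.

Lemma entrywise_frobenius m n (A B : 'M[R]_(m, n)) (h : R) :
  (forall i j, `|A i j - B i j| <= h) ->
  \sum_i \sum_j (A - B) i j ^+ 2 <= (m * n)%:R * h ^+ 2.
Proof.
move=> H; apply: (@le_trans _ _ (\sum_(i < m) \sum_(j < n) h ^+ 2)).
  apply: ler_sum => i _; apply: ler_sum => j _.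
  rewrite !mxE -[X in X <= _]ger0_norm ?sqr_ge0 // normrX.
  by rewrite lerXn2r ?nnegrE // (le_trans (normr_ge0 _) (H i j)).
by rewrite !sumr_const !card_ord -mulrnA -[X in X <= _]mulr_natl mulnC.
Qed.

End EuclideanSums.

(** * Nets of tensor trains, by left orthogonalization *)

Section TensorTrainNet.
Variables (R : realType) (rho : nat).
Implicit Types (W V : nat -> 'cV[R]_rho).

(* W j is the column, indexed by the bond, of the entries at j in a tail of a
   tensor train with p modes; t ranges over the unfoldings of that tail. *)
Definition tail_rank p W := forall t, (0 < t <= p)%N ->
  exists (U : nat -> 'M[R]_rho) (V : nat -> 'cV[R]_rho), forall lo hi,
    (lo < 2 ^ t)%N -> (hi < 2 ^ (p - t))%N -> W (lo + 2 ^ t * hi)%N = U lo *m V hi.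

Definition tail_sqn p W := \sum_(j < 2 ^ p) sqn (W j).

Lemma sum_ord_double (n : nat) (F : nat -> R) :
  \sum_(j < n.*2) F j = \sum_(j < n) (F j.*2 + F j.*2.+1).
Proof.
elim: n => [|n IH]; first by rewrite !big_ord0.
by rewrite doubleS !big_ord_recr /= IH addrA.
Qed.

Lemma tail_sqnS p W :
  tail_sqn p.+1 W = \sum_(j < 2 ^ p) sqn (col_mx (W j.*2) (W j.*2.+1)).
Proof.
rewrite /tail_sqn expnS mul2n (sum_ord_double _ (fun j => sqn (W j))).
by apply: eq_bigr => j _; rewrite sqn_col_mx.
Qed.

(** One step of left orthogonalization. The range of the partial isometry [Q] contains all stacked
    slices, and [V] is their image under [Q^T], itself a contraction, so the norm of the remaining
    tail does not grow. *)
Lemma tail_split p W : tail_rank p.+1 W ->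
  exists (Q : 'M[R]_(rho + rho, rho)) V,
    [/\ contractive_mx Q, tail_rank p V,
        forall j, (j < 2 ^ p)%N -> col_mx (W j.*2) (W j.*2.+1) = Q *m V j
      & tail_sqn p V <= tail_sqn p.+1 W].
Proof.
move=> rW; have [|U [Y UY]] := rW 1%N; first by [].
have [Q [QQ QU]] := gram_schmidt (col_mx (U 0%N) (U 1%N)).
have WE j : (j < 2 ^ p)%N ->
    col_mx (W j.*2) (W j.*2.+1) = col_mx (U 0%N) (U 1%N) *m Y j.
  move=> jp; rewrite mul_col_mx; congr col_mx.
    by rewrite -UY ?subn1 // add0n mul2n.
  by rewrite -UY ?subn1 // add1n mul2n.
exists Q, (fun j => Q^T *m col_mx (W j.*2) (W j.*2.+1)); split.
- exact: partial_isometry_contraction.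
(* A factorization of [V] at [t] comes from that of [W] at [t.+1], the first mode being absorbed
   into the left factor. *)
- move=> t /andP[t0 tp]; have [|A [B AB]] := rW t.+1; first by rewrite ltnS.
  exists (fun lo => Q^T *m col_mx (A lo.*2) (A lo.*2.+1)), B => lo hi lot hit.
  rewrite -mulmxA mul_col_mx -!AB ?subSS //; last 2 first.
  + by rewrite expnS mul2n ltn_Sdouble.
  + by rewrite expnS mul2n ltn_double.
  congr (_ *m col_mx (W _) (W _)).
    by rewrite doubleD expnS -!mul2n mulnA.
  by rewrite doubleD expnS -!mul2n mulnA.
- by move=> j jp; rewrite WE // !mulmxA QU.
- rewrite tail_sqnS; apply: ler_sum => j _.
  exact/partial_isometry_contraction/partial_isometry_tr.
Qed.

(** The parity of [j] is the digit of the first mode, which selects a slice of the core [Q]. *)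
Definition tail_join (Q : 'M[R]_(rho + rho, rho)) V (j : nat) : 'cV[R]_rho :=
  (if odd j then dsubmx Q else usubmx Q) *m V j./2.

Lemma tail_joinE Q V j :
  col_mx (tail_join Q V j.*2) (tail_join Q V j.*2.+1) = Q *m V j.
Proof.
rewrite /tail_join /= odd_double /= doubleK uphalf_double.
by rewrite -mul_col_mx vsubmxK.
Qed.

(** Induction over the modes: each core has [2 * rho ^ 2] entries with [2 * L + 1] grid values each,
    and adds one term [2 * rho / L] to the error. The closing vector at [p = 0] accounts for the
    extra unit in [p.+1]. *)
Lemma tail_net (L p : nat) : (0 < rho)%N -> (0 < L)%N ->
  exists (I : finType) (g : I -> nat -> 'cV[R]_rho),
    (#|I| <= (2 * L).+1 ^ (2 * rho ^ 2 * p.+1))%N /\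
    forall W, tail_rank p W -> tail_sqn p W <= 1 ->
      exists i, tail_sqn p (fun j => W j - g i j) <=
                (p.+1%:R * (2 * rho%:R / L%:R)) ^+ 2.
Proof.
move=> rho0 L0; set kappa : R := 2 * rho%:R / L%:R.
have kappa0 : 0 <= kappa by rewrite divr_ge0 // mulr_ge0.
have rho1 : 1 <= rho%:R :> R by rewrite (ler_nat R 1 rho).
(* [kappa] bounds the Frobenius norm of an error of [1 / L] in each of up to [4 * rho ^ 2]
   entries. *)
have kappaE (a : nat) : (a <= 4 * rho ^ 2)%N -> a%:R * L%:R^-1 ^+ 2 <= kappa ^+ 2.
  move=> aH; rewrite /kappa exprMn ler_wpM2r ?sqr_ge0 //.
  by rewrite exprMn -!natrX -natrM ler_nat.
elim: p => [|p [I [g [cI gP]]]].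
  have [||c [_ cP]] := @grid_net R rho 1 L (fun v => sqn v <= 1) L0.
  - move=> v v1 i j; rewrite (ord1 j) -(@expr_le1 _ 2) // real_normK ?num_real //.
    apply: le_trans v1; rewrite /sqn (bigD1 i) //= lerDl.
    by apply: sumr_ge0 => k _; exact: sqr_ge0.
  - by exists 0; rewrite sqn0.
  exists 'M['I_(2 * L).+1]_(rho, 1), (fun i _ => c i); split.
    by rewrite card_mx card_ord leq_exp2l ?muln1 //; nia.
  move=> W _; rewrite /tail_sqn !expn0 !big_ord1 /= => W1.
  have [i /entrywise_frobenius H] := cP _ W1; exists i.
  rewrite mul1r; apply: le_trans (kappaE (rho * 1)%N _); last by nia.
  by apply: le_trans H; rewrite big_ord1; apply: ler_sum => k _; rewrite big_ord1.
have [||c [cc cP]] :=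
    @grid_net R (rho + rho) rho L (fun Q => contractive_mx Q) L0.
- by move=> Q QC i j; exact: contraction_entry.
- by exists 0 => x; rewrite mul0mx sqn0 sqn_ge0.
exists (I * 'M['I_(2 * L).+1]_(rho + rho, rho))%type.
exists (fun i => tail_join (c i.2) (g i.1)); split.
  rewrite card_prod card_mx card_ord.
  apply: (leq_trans (leq_mul cI (leqnn _))).
  by rewrite -expnD leq_exp2l //; nia.
move=> W rW W1; have [Q [V [QC rV WE VW]]] := tail_split rW.
have V1 := le_trans VW W1.
have [i iP] := gP V rV V1; have [e /entrywise_frobenius H] := cP Q QC.
exists (i, e); rewrite tail_sqnS /=.
(* The tail error passes through the contraction [c e], hence is not amplified; the core error acts
   on [V], of norm at most 1. *)
have split_err (j : 'I_(2 ^ p)) :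
    col_mx (W j.*2 - tail_join (c e) (g i) j.*2)
           (W j.*2.+1 - tail_join (c e) (g i) j.*2.+1) =
    c e *m (V j - g i j) + (Q - c e) *m V j.
  by rewrite -add_col_mx -opp_col_mx tail_joinE WE // mulmxBr mulmxBl [RHS]addrC subrKA.
under eq_bigr => j _ do rewrite split_err.
rewrite -(natr1 p.+1) mulrDl mul1r; apply: sum_sqn_add_le => //.
- by rewrite mulr_ge0.
- by apply: le_trans iP; apply: ler_sum => j _; exact: cc.
apply: (@le_trans _ _ (\sum_(j < 2 ^ p) kappa ^+ 2 * sqn (V j))).
  apply: ler_sum => j _; apply: le_trans (sqn_mulmx_le _ _) _.
  rewrite ler_wpM2r ?sqn_ge0 //; apply: le_trans H _.
  by apply: kappaE; nia.
by rewrite -big_distrr /= -[X in _ <= X]mulr1 ler_wpM2l ?sqr_ge0.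
Qed.

End TensorTrainNet.

(** * Tensors as tensor-train tails, and the resulting net *)

Section TensorsAsTails.
Variables (R : realType) (d : nat).
Implicit Types X Y : tensor R d.

Definition flat X (j : nat) : R := X [ffun q : 'I_d => digit j q].

Lemma vecZ (a : R) X : vec (a *: X) = a *: vec X.
Proof. by apply/colP => j; rewrite !mxE ffunE. Qed.

Lemma vecB X Y : vec (X - Y) = vec X - vec Y.
Proof. by apply/colP => j; rewrite !mxE !ffunE. Qed.

Lemma digits_lt (i : mindex d) : (\sum_(q < d) i q * 2 ^ q < 2 ^ d)%N.
Proof.
have H n : (\sum_(q < n) 2 ^ q < 2 ^ n)%N.
  elim: n => [|n IH]; first by rewrite big_ord0.
  by rewrite big_ord_recr /= expnS mul2n -addnn -addSn leq_add.
apply: leq_ltn_trans (H d); apply: leq_sum => q _.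
by rewrite -[leqRHS]mul1n leq_mul2r -ltnS ltn_ord orbT.
Qed.

Definition undigits (i : mindex d) : 'I_(2 ^ d) := Ordinal (digits_lt i).

Definition digits (j : 'I_(2 ^ d)) : mindex d := [ffun q : 'I_d => digit j q].

Lemma undigitsK : cancel undigits digits.
Proof. by move=> i; apply/ffunP => q; rewrite ffunE digit_sum. Qed.

Lemma digits_inj : injective digits.
Proof.
apply: can_inj (undigits) _; apply: (bij_can_sym _ _).2; last exact: undigitsK.
apply: inj_card_bij; first exact: can_inj undigitsK.
by rewrite card_ffun !card_ord.
Qed.

Lemma vec_inj X : vec X = 0 -> X = 0.
Proof.
move=> X0; apply/ffunP => i; rewrite -[i]undigitsK.
by move/colP/(_ (undigits i)): X0; rewrite !mxE => ->; rewrite ffunE.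
Qed.

Definition nnz (I : finType) (f : I -> R) := #|[pred i | f i != 0]|.

Lemma nnz_vec X : (nnz (fun j => vec X j 0%R) <= nnz X)%N.
Proof.
rewrite /nnz -(fintype.card_image digits_inj); apply: subset_leq_card.
by apply/fintype.subsetP => _ /fintype.imageP[j + ->]; rewrite !inE mxE.
Qed.

Lemma digit_add_shift (q a b p : nat) : (a < 2 ^ q)%N ->
  digit (a + 2 ^ q * b) p = if (p < q)%N then digit a p else digit b (p - q).
Proof.
move=> aq; rewrite /digit; case: ltnP => pq; congr inord.
  have -> : (2 ^ q * b = (2 ^ (q - p.+1) * b) * 2 * 2 ^ p)%N.
    by rewrite -{1}(subnKC pq) expnD expnS; ring.
  by rewrite addnC divnMDl ?expn_gt0 // modnMDl.
rewrite -{1}(subnKC pq) expnD divnMA addnC mulnC divnMDl ?expn_gt0 //.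
by rewrite (divn_small aq) addn0.
Qed.
Lemma unfolding_flat X (q : nat) (a : 'I_(2 ^ q)) (b : 'I_(2 ^ (d - q))) :
  unfolding q X a b = flat X (a + 2 ^ q * b).
Proof.
rewrite mxE /flat; congr (X _); apply/ffunP => p; rewrite !ffunE.
by rewrite digit_add_shift.
Qed.

(** Zero padding makes the inner dimension [rho] whatever the rank. *)
Lemma rank_factorization m n rho (A : 'M[R]_(m, n)) : (\rank A <= rho)%N ->
  exists (U : 'M[R]_(m, rho)) (V : 'M[R]_(rho, n)), A = U *m V.
Proof.
move=> rA; exists (col_ebase A *m pid_mx (\rank A)), (pid_mx (\rank A) *m row_ebase A).
rewrite -mulmxA (mulmxA (pid_mx _)) mul_pid_mx minnn (minn_idPr rA).
by rewrite mulmxA mulmx_ebase.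
Qed.

(* The bond in front of the first mode has only its coordinate c in use. *)
Definition tensor_tail rho (c : 'I_rho) X (j : nat) : 'cV[R]_rho :=
  flat X j *: delta_mx c 0.

Lemma tensor_tail_rank rho (c : 'I_rho) X :
  tt_rank_le X rho -> tail_rank d (tensor_tail c X).
Proof.
move=> rX t /andP[t0]; rewrite leq_eqVlt => /predU1P[->|td].
  (* At [t = d] only [hi = 0] remains and the factorization is explicit; the TT rank covers
     [0 < t < d]. *)
  exists (fun j => flat X j *: delta_mx c c), (fun _ => delta_mx c 0) => lo hi _.
  rewrite subnn expn0 ltnS leqn0 => /eqP ->; rewrite muln0 addn0.
  by rewrite -scalemxAl mul_delta_mx.
have t'd : (t.-1 < d.-1)%N by lia.
have := rX (Ordinal t'd); rewrite tnth_mktuple /= prednK // => /rank_factorization.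
case=> [U [V UV]].
(* The row of [U] is placed in row [c] of a square matrix; the default 0 is for indices out of
   range. *)
exists (fun lo => oapp (fun i => delta_mx c 0 *m row i U) 0 (insub lo)).
exists (fun hi => oapp (fun i => col i V) 0 (insub hi)) => lo hi lot hit.
rewrite !insubT /= -mulmxA.
have -> : row (Sub lo lot) U *m col (Sub hi hit) V =
    (flat X (lo + 2 ^ t * hi))%:M.
  have := unfolding_flat X (Sub lo lot) (Sub hi hit); rewrite UV => /= <-.
  by apply/matrixP => i j; rewrite !ord1 !mxE eqxx; apply: eq_bigr => k _; rewrite !mxE.
by rewrite mul_mx_scalar.
Qed.

Lemma tensor_tail_sqn rho (c : 'I_rho) X Y :
  tail_sqn d (fun j => tensor_tail c X j - tensor_tail c Y j) = sqn (vec X - vec Y).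
Proof.
apply: eq_bigr => j _; rewrite -scalerBl sqnZ -vecB mxE /flat !ffunE.
rewrite (_ : sqn _ = 1) ?mulr1 // /sqn (bigD1 c) //= mxE !eqxx expr1n.
by rewrite big1 ?addr0 // => i /negbTE ic; rewrite mxE ic expr0n.
Qed.

(** The centres of [tail_net] are replaced by nearby elements of [T]: this doubles the radius but
    lets them inherit properties such as sparsity. *)
Lemma tensor_net (rho L : nat) (T : tensor R d -> Prop) :
  (0 < rho)%N -> (0 < L)%N ->
  (forall X, T X -> tt_rank_le X rho /\ sqn (vec X) <= 1) ->
  exists (I : finType) (h : I -> tensor R d),
    (#|I| <= (2 * L).+1 ^ (2 * rho ^ 2 * d.+1))%N /\
    forall X, T X -> exists i, T (h i) /\
      sqn (vec X - vec (h i)) <= (4 * d.+1%:R * rho%:R / L%:R) ^+ 2.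
Proof.
move=> rho0 L0 TP; pose c := Ordinal rho0.
have [I [g [cI gP]]] := @tail_net R rho L d rho0 L0.
set e := _ * _ in gP.
pose near i X := T X /\ tail_sqn d (fun j => tensor_tail c X j - g i j) <= e ^+ 2.
have /choice[h hP] i : exists Y, (exists X, near i X) -> near i Y.
  by have [[Y nY]|nY] := pselect (exists X, near i X); [exists Y|exists 0].
exists I, h; split=> // X TX; have [rX X1] := TP _ TX.
have [||i iP] := gP (tensor_tail c X); first exact: tensor_tail_rank.
  have := tensor_tail_sqn c X 0.
  have -> : vec (0 : tensor R d) = 0 by apply/colP => j; rewrite !mxE ffunE.
  rewrite subr0 => XE; rewrite -XE in X1; apply: le_trans X1.
  by apply: ler_sum => j _; rewrite /tensor_tail /flat ffunE scale0r subr0.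
have [Th hi] := hP i (ex_intro _ X (conj TX iP)); exists i; split=> //.
have e0 : 0 <= e by rewrite !mulr_ge0 // invr_ge0.
have -> : 4 * d.+1%:R * rho%:R / L%:R = e + e by rewrite /e; ring.
rewrite -(tensor_tail_sqn c) /tail_sqn.
have E j : tensor_tail c X j - tensor_tail c (h i) j =
    (tensor_tail c X j - g i j) + (g i j - tensor_tail c (h i) j).
  by rewrite subrKA.
under eq_bigr do rewrite E.
apply: sum_sqn_add_le => //; apply: le_trans hi; apply: ler_sum => j _.
by rewrite -opprB -scaleN1r sqnZ sqrrN expr1n mul1r.
Qed.

End TensorsAsTails.

(** * Sparsity of low-order tensors *)

Section LowOrderSupport.
Variables (R : realType) (d : nat).
Implicit Types X Y : tensor R d.

Lemma nnz_sum (I : finType) k (Y : 'I_k -> {ffun I -> R^o}) (b : nat) :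
  (forall t, nnz (Y t) <= b)%N -> (nnz (\sum_t Y t)%R <= k * b)%N.
Proof.
move=> Yb; apply: (@leq_trans (\sum_(t < k) nnz (Y t))); last first.
  by rewrite -[in leqRHS](card_ord k) -sum_nat_const; apply: leq_sum.
elim/big_rec2: _ => [|t n Z _ IH].
  by rewrite /nnz eq_card0 // => i; rewrite !inE ffunE eqxx.
apply: leq_trans (leq_add (leqnn _) IH); rewrite /nnz -cardUI.
apply: leq_trans (leq_addr _ _); apply: subset_leq_card.
apply/fintype.subsetP => i; rewrite !inE ffunE.
by apply: contraR; rewrite negb_or !negbK => /andP[/eqP-> /eqP->]; rewrite addr0.
Qed.

(** The spanning tensors are supported at the indicators of the subsets of [S]. *)
Lemma nnz_span_tensor (S : {set 'I_d}) Y :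
  Y \in span_tensor R S -> (nnz Y <= 2 ^ #|S|)%N.
Proof.
move=> YS; rewrite -card_powerset.
pose chi (J : {set 'I_d}) : mindex d := [ffun p => if p \in J then ord_max else ord0].
apply: (@leq_trans #|[seq chi J | J in powerset S]|); last exact: leq_image_card.
apply: subset_leq_card; apply/fintype.subsetP => i; rewrite !inE.
apply: contraR => iS; move: YS; rewrite /span_tensor => /coord_span ->.
rewrite sum_ffunE big1 // => j _; rewrite ffunE.
have jlt : (j < size [seq basis_tensor R J | J <- enum (powerset S)])%N.
  by rewrite size_map -cardE.
have /mapP[J JS ->] := mem_nth 0 jlt.
rewrite ffunE; case: eqP => [iJ|]; last by rewrite scaler0.
case/negP: iS; rewrite iJ; apply/fintype.imageP; exists J => //.
by rewrite -mem_enum.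
Qed.

Lemma nnz_low_order s k X : low_order s k X -> (nnz X <= k * 2 ^ s)%N.
Proof.
case=> [S [Y [SY ->]]]; apply: nnz_sum => t; have [St Yt] := SY t.
by apply: leq_trans (nnz_span_tensor Yt) _; rewrite leq_exp2l.
Qed.

Lemma nnzB X Y : (nnz (X - Y)%R <= nnz X + nnz Y)%N.
Proof.
rewrite /nnz -cardUI; apply: leq_trans (leq_addr _ _); apply: subset_leq_card.
apply/fintype.subsetP => i; rewrite !inE !ffunE.
by apply: contraR; rewrite negb_or !negbK => /andP[/eqP-> /eqP->]; rewrite subr0.
Qed.

End LowOrderSupport.

(** * Orthogonality and flatness of the Hadamard matrix *)

Section Hadamard.
Variables (R : realType) (d : nat).

Lemma tensmx_orthogonal m n (A : 'M[R]_m) (B : 'M[R]_n) :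
  A^T *m A = 1%:M -> B^T *m B = 1%:M -> (A *t B)^T *m (A *t B) = 1%:M.
Proof.
move=> AA BB; rewrite trmx_tens tensmx_mul AA BB.
apply/matrixP => i j; case: (mxtens_indexP i) => i1 i2.
case: (mxtens_indexP j) => j1 j2; rewrite tensmxE !mxE -natrM mulnb.
by rewrite (can_eq (@mxtens_indexK _ _)) xpair_eqE.
Qed.

Lemma hadamard2_orthogonal : (hadamard2 R)^T *m hadamard2 R = 1%:M.
Proof.
have s2 : (Num.sqrt 2)^-1 * (Num.sqrt 2)^-1 = 2^-1 :> R.
  by rewrite -invfM -expr2 sqr_sqrtr.
apply/matrixP => i j; rewrite !mxE big_ord_recl big_ord1 !mxE.
rewrite mulrACA s2 mulrACA s2 -mulrDr /= mul0n expr0 mul1r /bump /= !mul1n.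
case: i => -[|[|//]] ?; case: j => -[|[|//]] ? /=;
  rewrite ?expr0 ?expr1; lra.
Qed.

Lemma hadamard_orthogonal : (hadamard R d)^T *m hadamard R d = 1%:M.
Proof.
rewrite /hadamard; case: d => [|n]; first by rewrite ntensmx0 trmx1 mulmx1.
elim: n => [|n IH]; first by rewrite ntensmx1 hadamard2_orthogonal.
by rewrite ntensmxSS; exact: (tensmx_orthogonal hadamard2_orthogonal IH).
Qed.

Lemma hadamard_entry_sqr i j : hadamard R d i j ^+ 2 = (2 ^ d)%:R^-1.
Proof.
have h2 a b : hadamard2 R a b ^+ 2 = 2^-1.
  by rewrite !mxE exprMn sqrr_sign mulr1 exprVn sqr_sqrtr.
move: i j; rewrite /hadamard; case: d => [|n].
  by move=> i j; rewrite ntensmx0 !mxE [i]ord1 [j]ord1 expr1n invr1.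
elim: n => [|n IH]; first by move=> i j; rewrite ntensmx1 h2.
rewrite ntensmxSS => i j; case: (mxtens_indexP i) => i1 i2.
case: (mxtens_indexP j) => j1 j2.
by rewrite tensmxE exprMn h2 IH -invfM -natrM.
Qed.

Lemma hadamard_sqn (v : 'cV[R]_(2 ^ d)) : sqn (hadamard R d *m v) = sqn v.
Proof.
have : (sqn (hadamard R d *m v))%:M = (sqn v)%:M :> 'M[R]_1.
  by rewrite !sqnE trmx_mul -mulmxA (mulmxA _ _ v) hadamard_orthogonal mul1mx.
by move/matrixP/(_ 0 0); rewrite !mxE eqxx !mulr1n.
Qed.

Lemma pow2_gt0 : 0 < (2 ^ d)%:R :> R.
Proof. by rewrite ltr0n expn_gt0. Qed.

(** Cauchy-Schwarz on the support of [v], all entries of the Hadamard matrix having square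
    [1 / 2 ^ d]. *)
Lemma hadamard_sparse_sup (v : 'cV[R]_(2 ^ d)) j :
  (2 ^ d)%:R * (hadamard R d *m v) j 0 ^+ 2 <= (nnz (fun i => v i 0))%:R * sqn v.
Proof.
pose f i := hadamard R d j i * (v i 0 != 0)%:R.
have -> : (hadamard R d *m v) j 0 = \sum_i f i * v i 0.
  rewrite mxE; apply: eq_bigr => i _; rewrite /f.
  by have [->|_] := eqVneq (v i 0) 0; rewrite ?mulr0 ?mulr1.
have fE : \sum_i f i ^+ 2 = (2 ^ d)%:R^-1 * (nnz (fun i => v i 0))%:R.
  rewrite /nnz -sum1_card natr_sum big_distrr /= [RHS]big_mkcond /=.
  apply: eq_bigr => i _; rewrite /f exprMn hadamard_entry_sqr inE.
  by case: eqVneq => _; rewrite /= ?mulr1 ?expr1n ?mulr1 // expr0n mulr0.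
have := sum_mul_sqr_le f (fun i => v i 0); rewrite fE.
rewrite -(ler_pM2l pow2_gt0) -!mulrA => /le_trans; apply.
by rewrite mulVKf ?gt_eqF ?pow2_gt0.
Qed.

(* The energy 2^d (H v)_j ^ 2 has mean 1 and maximum at most B, hence is not
   small on a proportion of the rows of order 1 / B. *)
Lemma card_low_energy (v : 'cV[R]_(2 ^ d)) (B : R) : 0 < B ->
  sqn v = 1 -> (nnz (fun i => v i 0))%:R <= B ->
  #|[pred j | (2 ^ d)%:R * (hadamard R d *m v) j 0 ^+ 2 < 4^-1]|%:R <=
    (2 ^ d)%:R * (1 - 3 / (4 * B)).
Proof.
move=> B0 v1 vB; set N := (2 ^ d)%:R; set low := [pred j | _].
pose a j := N * (hadamard R d *m v) j 0 ^+ 2.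
have aB j : a j <= B.
  by apply: le_trans (hadamard_sparse_sup v j) _; rewrite v1 mulr1.
have suma : \sum_j a j = N.
  by rewrite -big_distrr /= -[RHS]mulr1 -v1 -hadamard_sqn.
(* An energy is at most 1/4 on a low row and at most [B] elsewhere. *)
have : \sum_j a j <= \sum_j ((j \in low)%:R * 4^-1 + (1 - (j \in low)%:R) * B).
  apply: ler_sum => j _; rewrite inE -/(a j).
  case: ltP => [/ltW ?|_] /=; first by rewrite mul1r subrr mul0r addr0.
  by rewrite mul0r subr0 mul1r add0r.
rewrite suma big_split /= -!big_distrl /= sumrB sumr_const card_ord.
have -> : \sum_j (j \in low)%:R = #|low|%:R :> R.
  by rewrite -sum1_card natr_sum [RHS]big_mkcond; apply: eq_bigr => j _; case: (j \in low).
rewrite -[1 *+ (2 ^ d)]/N; set c := #|low|%:R => H.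
rewrite -(ler_pM2r B0) mulrBr mulr1 mulrBl.
have -> : N * (3 / (4 * B)) * B = N * 3 / 4 by field; rewrite gt_eqF.
(* The sum gives [N <= c / 4 + (N - c) * B]; bounding [c / 4] by [N / 4] concludes. *)
have : c <= N by rewrite ler_nat -[leqRHS](card_ord (2 ^ d)) max_card.
lra.
Qed.

End Hadamard.

(** * Independent uniform samples and the union bound *)

Section UniformSampling.
Variables (R : realType) (dsp : measure_display) (Omega : measurableType dsp).
Variables (P : probability Omega R) (V : finType) (m : nat).
Variable nu : 'I_m -> Omega -> V.
Hypothesis nu_iid : iid_uniform P nu.

Lemma bigsetU_measure_le (I : Type) (r : seq I) (D : pred I) (F : I -> set Omega) :
  (forall i, measurable (F i)) ->
  (P (\big[setU/set0]_(i <- r | D i) F i) <= \sum_(i <- r | D i) P (F i))%E.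
Proof.
move=> mF; elim: r => [|i r IH]; first by rewrite !big_nil measure0.
rewrite !big_cons; case: ifP => // _.
have mU : measurable (\big[setU/set0]_(j <- r | D j) F j).
  exact: bigsetU_measurable.
exact: (le_trans (measureU2 _ (mF i) mU) (leeD (lexx _) IH)).
Qed.

Lemma preimage_sample (l : 'I_m) (S : pred V) :
  nu l @^-1` [set` S] = \big[setU/set0]_(v in S) (nu l @^-1` [set v]).
Proof.
rewrite -bigcup_pred; apply/seteqP; split=> w /=; first by exists (nu l w).
by case=> v Sv /= ->.
Qed.

(** The sample takes finitely many values, so the event is a finite union over those satisfying
    [G]. *)
Lemma measurable_sample (G : ('I_m -> V) -> Prop) :
  measurable [set w | G (nu^~ w)].
Proof.
have -> : [set w | G (nu^~ w)] =
    \big[setU/set0]_(f in [pred f : {ffun 'I_m -> V} | `[< G f >]])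
      \bigcap_(l in [set: 'I_m]) (nu l @^-1` [set f l]).
  rewrite -bigcup_pred; apply/seteqP; split=> w /=.
    move=> Gw; exists [ffun l => nu l w] => /=; last by move=> l _; rewrite /= ffunE.
    have e : nu^~ w = [ffun l => nu l w] by apply/funext => l; rewrite ffunE.
    by rewrite inE -e.
  case=> f /=; rewrite inE => Gf fw.
  have -> : nu^~ w = f by apply/funext => l; rewrite (fw l).
  exact: Gf.
apply: bigsetU_measurable => f _; apply: fin_bigcap_measurable => // l _.
by case: nu_iid => + _ _; apply.
Qed.

(** Independence gives a product of [m] factors, each at most [q] by uniformity. *)
Lemma probability_sample_in (S : pred V) (q : R) :
  #|S|%:R <= #|V|%:R * q -> (0 < #|V|)%N ->
  (P [set w | forall l, nu l w \in S] <= (q ^+ m)%:E)%E.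
Proof.
move=> Sq V0; have [mnu Pnu indep] := nu_iid.
have := indep [set: 'I_m]%SET (fun _ => [set` S]).
have -> : \bigcap_(l in [set` [set: 'I_m]%SET]) (nu l @^-1` [set` S]) =
    [set w | forall l, nu l w \in S].
  by apply/seteqP; split=> w /= wS l => [|_]; apply: wS; rewrite /= inE.
move=> ->; have q0 : 0 <= q.
  by move: Sq; rewrite -(@pmulr_rge0 _ #|V|%:R q) ?ltr0n //; apply: le_trans.
have Pl l : (P (nu l @^-1` [set` S]) <= q%:E)%E.
  rewrite preimage_sample; apply: le_trans (bigsetU_measure_le _ _ _) _ => //.
  rewrite (eq_bigr _ (fun v _ => Pnu l v)) sumEFin lee_fin sumr_const.
  by rewrite -[X in X <= _]mulr_natl mulrC ler_pdivrMl ?ltr0n.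
have -> : (q ^+ m)%:E = (\prod_(l in [set: 'I_m]%SET) q%:E)%E.
  rewrite prodEFin; congr EFin.
  by rewrite prodr_const cardsT card_ord.
(* Nonnegativity is carried through the induction because multiplying inequalities requires it. *)
suff : (0 <= \prod_(l in [set: 'I_m]%SET) P (nu l @^-1` [set` S]) <=
    \prod_(l in [set: 'I_m]%SET) q%:E)%E by case/andP.
elim/big_rec2: _ => [|l x y _ /andP[x0 xy]]; first by rewrite lee01 lexx.
by rewrite mule_ge0 //= lee_pmul.
Qed.

Lemma probability_all_escape (I : finType) (S : I -> pred V) (q delta : R)
    (G : ('I_m -> V) -> Prop) :
  (0 < #|V|)%N -> (forall i, #|S i|%:R <= #|V|%:R * q) ->
  #|I|%:R * q ^+ m <= delta ->
  (forall f, ~ G f -> exists i, forall l, f l \in S i) ->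
  ((1 - delta)%:E <= P [set w | G (nu^~ w)])%E.
Proof.
move=> V0 Sq Id GS.
have PC : (P (~` [set w | G (nu^~ w)]) <= delta%:E)%E.
  pose F i := [set w | forall l, nu l w \in S i].
  have mF i : measurable (F i).
    exact: (measurable_sample (fun f => forall l, f l \in S i)).
  have sub : ~` [set w | G (nu^~ w)] `<=` \big[setU/set0]_(i in I) F i.
    by move=> w /GS[i Si]; rewrite -bigcup_pred; exists i.
  apply: (@le_trans _ _ (P (\big[setU/set0]_(i in I) F i))).
    apply: le_measure sub; rewrite inE; last exact: bigsetU_measurable.
    by apply: measurableC; exact: measurable_sample.
  apply: le_trans (bigsetU_measure_le _ _ mF) _.
  apply: (@le_trans _ _ (\sum_(i in I) (q ^+ m)%:E)%E).
    by apply: lee_sum => i _; exact: probability_sample_in.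
  by rewrite sumEFin lee_fin sumr_const -[X in X <= _]mulr_natl.
rewrite -(setCK [set w | _]) probability_setC; last first.
  by apply: measurableC; exact: measurable_sample.
by rewrite EFinB leeB.
Qed.

End UniformSampling.

(** * From the absence of kernel elements to unique recovery *)

Section KernelEscape.
Variables (R : realType) (d m : nat).
Implicit Types X Y : tensor R d.

Definition sparse_tt_sphere (rho B : nat) X :=
  [/\ tt_rank_le X rho, (nnz X <= B)%N & sqn (vec X) = 1].

Lemma unfoldingD q X Y : unfolding q (X + Y) = unfolding q X + unfolding q Y.
Proof. by apply/matrixP => i j; rewrite !mxE ffunE. Qed.

Lemma unfoldingZ q (a : R) X : unfolding q (a *: X) = a *: unfolding q X.
Proof. by apply/matrixP => i j; rewrite !mxE ffunE. Qed.

Lemma tt_rank_leB X Y r1 r2 :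
  tt_rank_le X r1 -> tt_rank_le Y r2 -> tt_rank_le (X - Y) (r1 + r2).
Proof.
move=> rX rY q; have := rX q; have := rY q; rewrite !tnth_mktuple => yr xr.
rewrite -scaleN1r unfoldingD unfoldingZ.
by rewrite (leq_trans (mxrank_add _ _)) // leq_add // (leq_trans (mxrank_scale _ _)).
Qed.

Lemma tt_rank_leZ (a : R) X r : tt_rank_le X r -> tt_rank_le (a *: X) r.
Proof.
move=> rX q; have := rX q; rewrite !tnth_mktuple => xr.
by rewrite unfoldingZ (leq_trans (mxrank_scale _ _)).
Qed.

Lemma nnzZ (a : R) X : (nnz (a *: X)%R <= nnz X)%N.
Proof.
apply: subset_leq_card; apply/fintype.subsetP => i; rewrite !inE ffunE.
by apply: contraNneq => ->; rewrite scaler0.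
Qed.

Lemma measure_opE (nu : 'I_m -> 'I_(2 ^ d)) X l :
  measure_op nu X l 0 =
  Num.sqrt ((2 ^ d)%:R / m%:R) * (hadamard R d *m vec X) (nu l) 0.
Proof.
rewrite /measure_op /sensing_mx -scalemxAl -mulmxA !mxE; congr (_ * _).
rewrite (bigD1 (nu l)) //= big1 ?addr0; first by rewrite !mxE eqxx mul1r.
by move=> j jl; rewrite !mxE eq_sym (negbTE jl) mul0r.
Qed.

Lemma measure_op_kernel (nu : 'I_m -> 'I_(2 ^ d)) X : (0 < m)%N ->
  measure_op nu X = 0 -> forall l, (hadamard R d *m vec X) (nu l) 0 = 0.
Proof.
move=> m0 AX l; have := measure_opE nu X l; rewrite AX mxE => /esym/eqP.
rewrite mulf_eq0 gt_eqF /= => [/eqP //|].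
by rewrite sqrtr_gt0 divr_gt0 ?pow2_gt0 // ltr0n.
Qed.

(** On sampled rows the transform of [X] vanishes, so [Y] has there the energy of [X - Y], which is
    small because [X - Y] is short and still sparse. *)
Lemma kernel_low_energy (nu : 'I_m -> 'I_(2 ^ d)) (B : nat) X Y : (0 < m)%N ->
  (0 < B)%N -> (nnz X <= B)%N -> (nnz Y <= B)%N ->
  sqn (vec X - vec Y) <= (4 * B%:R)^-1 ^+ 2 -> measure_op nu X = 0 ->
  forall l, (2 ^ d)%:R * (hadamard R d *m vec Y) (nu l) 0 ^+ 2 < 4^-1.
Proof.
move=> m0 B0 XB YB XY AX l; have HX := measure_op_kernel m0 AX l.
have -> : (hadamard R d *m vec Y) (nu l) 0 ^+ 2 =
    (hadamard R d *m vec (X - Y)) (nu l) 0 ^+ 2.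
  by rewrite vecB mulmxBr [RHS]/= !mxE in HX *; rewrite HX sub0r sqrrN.
apply: le_lt_trans (hadamard_sparse_sup _ _) _; rewrite vecB.
have B1 : 1 <= B%:R :> R by rewrite (ler_nat R 1 B).
apply: (@le_lt_trans _ _ ((2 * B%:R) * (4 * B%:R)^-1 ^+ 2)).
  apply: ler_pM => //; first exact: sqn_ge0.
  rewrite -natrM ler_nat -vecB; apply: leq_trans (nnz_vec _) _.
  apply: leq_trans (nnzB _ _) _; lia.
have -> : (2 * B%:R) * (4 * B%:R)^-1 ^+ 2 = 8^-1 * B%:R^-1 :> R.
  by field; rewrite gt_eqF // (lt_le_trans _ B1).
have : B%:R^-1 <= 1 :> R by rewrite invf_le1 // (lt_le_trans _ B1).
lra.
Qed.

Lemma measure_opB (nu : 'I_m -> 'I_(2 ^ d)) X Y :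
  measure_op nu (X - Y) = measure_op nu X - measure_op nu Y.
Proof. by rewrite /measure_op vecB mulmxBr. Qed.

(** The objective is 0 at [Xstar], so another minimizer [Z] has the same measurements, and
    normalizing [Z - Xstar] gives a kernel element on the sphere. *)
Lemma unique_minimizer (nu : 'I_m -> 'I_(2 ^ d)) (r s k : nat) (C : R) Xstar :
  model_class r s k C Xstar ->
  (forall X, sparse_tt_sphere (2 * r) (2 * k * 2 ^ s) X -> measure_op nu X != 0) ->
  minimizers (model_class r s k C)
    (fun X => norm2 (measure_op nu X - measure_op nu Xstar)) = [set Xstar].
Proof.
move=> MX inj; have norm0 : norm2 (measure_op nu Xstar - measure_op nu Xstar) = 0.
  by rewrite subrr -[norm2 _]/(Num.sqrt (sqn _)) sqn0 sqrtr0.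
apply/seteqP; split=> [Z [MZ /(_ _ MX)]|_ ->]; last first.
  by split=> // Y _; rewrite norm0 sqrtr_ge0.
rewrite norm0 -[norm2 _]/(Num.sqrt (sqn _)) => Z0.
have {Z0} : Num.sqrt (sqn (measure_op nu Z - measure_op nu Xstar)) == 0.
  by rewrite eq_le Z0 sqrtr_ge0.
rewrite sqrtr_eq0 => Z0.
have /sqn_eq0 : sqn (measure_op nu Z - measure_op nu Xstar) = 0.
  by apply/eqP; rewrite eq_le Z0 sqn_ge0.
rewrite -measure_opB => AD; apply: contrapT => ZX.
set D := Z - Xstar in AD; have D0 : sqn (vec D) != 0.
  by apply/eqP => /sqn_eq0/vec_inj/subr0_eq.
have Dp : 0 < sqn (vec D) by rewrite lt_neqAle eq_sym D0 sqn_ge0.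
pose a := (Num.sqrt (sqn (vec D)))^-1.
have /inj/eqP[] : sparse_tt_sphere (2 * r) (2 * k * 2 ^ s) (a *: D).
  case: MX => [rX oX _]; case: MZ => [rZ oZ _]; split.
  - by apply: tt_rank_leZ; rewrite mul2n -addnn; exact: tt_rank_leB.
  - apply: leq_trans (nnzZ _ _) _; apply: leq_trans (nnzB _ _) _.
    by rewrite -mulnA mul2n -addnn leq_add //; exact: nnz_low_order.
  - by rewrite vecZ sqnZ exprVn sqr_sqrtr ?sqn_ge0 // mulVf.
by rewrite /measure_op vecZ -scalemxAr -/(measure_op nu D) AD scaler0.
Qed.

End KernelEscape.

(** * Arithmetic of the sample size *)

Section SampleComplexity.
Variable R : realType.

(** With [ell] and [W] the two terms in the bracket, [N] is at most [expR (4 * W)], while the bound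
    on [m] makes the power at most [expR (- 12 * (ell + W))]; the product is at most [expR (- ell)],
    hence at most [delta]. *)
Lemma sample_complexity (d r s k m N : nat) (eps delta : R) :
  let B := (2 * k * 2 ^ s)%N in let rho := (2 * r)%N in
  let L := (16 * d.+1 * rho * B)%N in
  (2 <= d)%N -> (1 <= r)%N -> (1 <= k)%N -> 0 < eps < 1 -> 0 < delta < 1 ->
  16 * (2 * k%:R) * 2 ^+ s / eps ^+ 2 *
      (ln (2 / delta) +
       2 * d%:R * (2 * r%:R) ^+ 2 *
         ln (16 * 1 * d%:R * Num.sqrt (2 * r%:R) * (2 * k%:R) * 2 ^+ s / eps))
      <= m%:R ->
  (N <= (2 * L).+1 ^ (2 * rho ^ 2 * d.+1))%N ->
  (0 < m)%N /\ N%:R * (1 - 3 / (4 * B%:R)) ^+ m <= delta.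
Proof.
move=> B rho L d2 r1 k1 /andP[e0 e1] /andP[de0 de1].
have bE : 2 * k%:R * 2 ^+ s = B%:R :> R by rewrite /B !natrM natrX.
have rhoE : 2 * r%:R = rho%:R :> R by rewrite /rho natrM.
rewrite mulr1 -!(mulrA _ (2 * k%:R)) bE rhoE.
set b : R := B%:R; set p : R := rho%:R; set D : R := d%:R.
set Z := Num.sqrt p; set ell := ln _; set Lam := ln _ => mB NM.
have B2 : (2 <= B)%N by rewrite /B -mulnA leq_pmulr // muln_gt0 k1 expn_gt0.
have rho2 : (2 <= rho)%N by rewrite /rho leq_pmulr.
clearbody B rho.
have b2 : 2 <= b by rewrite (ler_nat R 2 B).
have p2 : 2 <= p by rewrite (ler_nat R 2 rho).
have D2 : 2 <= D by rewrite (ler_nat R 2 d).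
have Zp : Z ^+ 2 = p by rewrite sqr_sqrtr //; lra.
have Z1 : 1 <= Z by rewrite -sqrtr1 ler_wsqrtr //; lra.
pose c := 16 * D * Z * b; have c0 : 0 < c by rewrite !mulr_gt0 //; lra.
have pb4 : 4 <= p * b by nra.
have Dpb : 2 * (p * b) <= D * (p * b) by rewrite ler_wpM2r //; lra.
have Db : 4 <= D * b by nra.
set M : R := (2 * L).+1%:R.
(* [M] grows with [p] but [c] only with its root, hence the square, which costs the factor 2 in
   [lnM]. *)
have Mc : M <= c ^+ 2.
  have -> : c ^+ 2 = 256 * ((D * b) * (D * (p * b))).
    by rewrite /c !exprMn Zp; ring.
  have -> : M = 32 * (D + 1) * (p * b) + 1.
    by rewrite /M /L -natr1 !natrM -(natr1 d); rewrite -/D -/p -/b; ring.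
  have : 4 * (D * (p * b)) <= (D * b) * (D * (p * b)).
    by rewrite ler_wpM2r //; lra.
  lra.
have M1 : 1 <= M by rewrite (ler_nat R 1).
have lnM0 : 0 <= ln M by exact: ln_ge0.
have M0 : 0 < M by lra.
have lnM : ln M <= 2 * Lam.
  apply: (@le_trans _ _ (ln (c ^+ 2))).
    by rewrite ler_ln ?posrE // exprn_gt0.
  rewrite lnXn // -[X in X <= _]mulr_natl ler_wpM2l // ler_ln ?posrE //; last first.
    by rewrite divr_gt0.
  by rewrite ler_pdivlMr // ger_pMr // ltW.
have Lam0 : 0 <= Lam by lra.
have ell_delta : - ln delta <= ell.
  rewrite -lnV ?posrE // ler_ln ?posrE ?invr_gt0 ?divr_gt0 //.
  by rewrite ler_peMl ?invr_ge0 ?ltW //; lra.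
have ell0 : 0 < ell.
  by rewrite ln_gt0 // ltr_pdivlMr //; lra.
set W := 2 * D * p ^+ 2 * Lam in mB.
have W0 : 0 <= W by rewrite !mulr_ge0 ?sqr_ge0 //; lra.
(* The factor [1 / eps ^ 2] is at least 1 and is dropped. *)
have mB' : 16 * b * (ell + W) <= m%:R.
  apply: le_trans mB; apply: ler_wpM2r; first by rewrite addr_ge0 // ltW.
  apply: ler_peMr; first by lra.
  by rewrite invf_ge1 ?exprn_gt0 // expr_le1 // ltW.
have mpos : 0 < m%:R :> R.
  by apply: lt_le_trans mB'; rewrite !mulr_gt0 //; lra.
split; first by rewrite -(ltr0n R).
set q := 1 - 3 / (4 * b).
have b3 : 3 / (4 * b) <= 1 by rewrite ler_pdivrMr ?mulr_gt0 //; lra.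
have q0 : 0 <= q by rewrite /q; lra.
have qm : q ^+ m <= expR (m%:R * - (3 / (4 * b))).
  by rewrite expRM_natl lerXn2r ?nnegrE ?expR_ge0 // expR_ge1Dx.
(* The exponent [2 * p ^ 2 * (D + 1)] is at most [4 * D * p ^ 2]. *)
have NE : N%:R <= expR (4 * W).
  apply: (@le_trans _ _ (expR ((2 * rho ^ 2 * d.+1)%:R * ln M))).
    by rewrite expRM_natl lnK ?posrE // /M -natrX ler_nat.
  rewrite ler_expR.
  have -> : (2 * rho ^ 2 * d.+1)%:R = 2 * p ^+ 2 * (D + 1).
    by rewrite 2!natrM natrX -(natr1 d).
  have -> : 4 * W = (4 * D * p ^+ 2) * (2 * Lam) by rewrite /W; ring.
  apply: ler_pM => //; first by rewrite !mulr_ge0 ?sqr_ge0 //; lra.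
  have : p ^+ 2 * 1 <= p ^+ 2 * D by rewrite ler_wpM2l ?sqr_ge0 //; lra.
  lra.
apply: (@le_trans _ _ (expR (4 * W) * expR (m%:R * - (3 / (4 * b))))).
  by apply: ler_pM => //; rewrite exprn_ge0.
rewrite -expRD -[leRHS](@lnK R) ?posrE // ler_expR.
have : 12 * (ell + W) <= m%:R * (3 / (4 * b)).
  have -> : 12 * (ell + W) = (16 * b * (ell + W)) * (3 / (4 * b)).
    by field; rewrite gt_eqF //; lra.
  by rewrite ler_wpM2r // divr_ge0 //; lra.
lra.
Qed.

End SampleComplexity.

(** * Unique recovery with high probability *)

Theorem mainTheorem3 (R : realType) :
  exists K : R, 0 < K /\
    forall (d r s k m : nat) (C eps delta : R)
      (dsp : measure_display) (Omega : measurableType dsp)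
      (P : probability Omega R) (nu : 'I_m -> Omega -> 'I_(2 ^ d))
      (Xstar : tensor R d),
    (2 <= d)%N -> (1 <= r)%N -> (1 <= k)%N -> (s <= d)%N ->
    0 < C -> 0 < eps < 1 -> 0 < delta < 1 ->
    iid_uniform P nu ->
    model_class r s k C Xstar ->
    16 * (2 * k%:R) * 2 ^+ s / eps ^+ 2 *
      (ln (2 / delta) +
       2 * d%:R * (2 * r%:R) ^+ 2 *
         ln (16 * K * d%:R * Num.sqrt (2 * r%:R) * (2 * k%:R) * 2 ^+ s / eps))
      <= m%:R ->
    ((1 - delta)%:E <=
      P [set w | let A := measure_op (fun l => nu l w) in
                 let y := A Xstar in
                 minimizers (model_class r s k C)
                   (fun X : tensor R d => norm2 (A X - y)) = [set Xstar]])%E.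
Proof.
exists 1; split; first exact: ltr01.
move=> d r s k m C eps delta dsp Omega P nu Xstar d2 r1 k1 _ _ heps hdelta iid MX hm.
set B := (2 * k * 2 ^ s)%N; set rho := (2 * r)%N.
(* Chosen so that the net radius [4 * d.+1 * rho / L] is exactly [1 / (4 * B)]. *)
set L := (16 * d.+1 * rho * B)%N.
have B0 : (0 < B)%N by rewrite !muln_gt0 k1 expn_gt0.
have rho0 : (0 < rho)%N by rewrite muln_gt0.
have L0 : (0 < L)%N by rewrite muln_gt0 B0 muln_gt0 rho0.
have LE : 4 * d.+1%:R * rho%:R / L%:R = (4 * B%:R)^-1 :> R.
  rewrite /L; move: (d.+1) (ltn0Sn d) (rho) rho0 (B) B0 => a a0 x x0 y y0.
  rewrite !natrM; field.
  by rewrite !pnatr_eq0 -!lt0n a0 x0 y0.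
have [|I [h [cI hP]]] := @tensor_net R d rho L (sparse_tt_sphere rho B) rho0 L0.
  by move=> X [rX _ ->].
have [m0 cm] := sample_complexity d2 r1 k1 heps hdelta hm cI.
pose low Y := [pred j | (2 ^ d)%:R * (hadamard R d *m vec Y) j 0 ^+ 2 < 4^-1].
have BE : B%:R = 2 * k%:R * 2 ^+ s :> R by rewrite /B !natrM natrX.
pose G (f : 'I_m -> 'I_(2 ^ d)) := minimizers (model_class r s k C)
  (fun X : tensor R d => norm2 (measure_op f X - measure_op f Xstar)) = [set Xstar].
rewrite -[X in P X]/[set w | G (fun l => nu l w)].
pose Y := [pred i | `[< sparse_tt_sphere rho B (h i) >]].
(* Centres off the sphere get the empty set, so that the cardinality bound holds for every index. *)
pose S i : pred 'I_(2 ^ d) := if Y i then low (h i) else pred0.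
have q0 : 0 <= 1 - 3 / (4 * B%:R) :> R.
  have : 3 / (4 * B%:R) <= 1 :> R.
    have B2 : (2 <= B)%N by rewrite /B -mulnA leq_pmulr // muln_gt0 k1 expn_gt0.
    have : 2 <= B%:R :> R by rewrite (ler_nat R 2 B).
    by move=> ?; rewrite ler_pdivrMr ?mulr_gt0 //; lra.
  lra.
apply: (probability_all_escape (S := S) iid _ _ cm).
- by rewrite card_ord expn_gt0.
- move=> i; rewrite card_ord /S; case: ifP => [|_]; last first.
    by rewrite card0 mulr_ge0.
  move=> /asboolP[_ hB h1]; apply: card_low_energy => //; first by rewrite ltr0n.
  by rewrite ler_nat (leq_trans (nnz_vec _)).
(* A kernel element on the sphere would have a net point whose low-energy rows contain all
   samples. *)
- move=> f; apply: contra_notP => noi; apply: unique_minimizer => // X TX.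
  apply/eqP => AX; apply: noi; have [i [Ti Xi]] := hP X TX.
  exists i => l; rewrite /S ifT; last exact/asboolP.
  rewrite inE; case: TX => _ XB _; case: Ti => _ hB _.
  apply: (kernel_low_energy (B := B) m0 B0 XB hB _ AX).
  apply: le_trans Xi _; rewrite le_eqVlt; apply/orP; left; apply/eqP.
  by rewrite LE.
Qed.
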